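(* Let $p$ be an odd prime and let $T_p$ be the signed sum over starters in $\mathbb F_p$ defined in the context. Then $$T_p\equiv-\left(\frac{2}{p}\right)\pmod p,$$ where $\left(\frac{\cdot}{p}\right)$ is the Legendre symbol. In particular, $T_p^2\equiv1\pmod p$.
   Context: A starter in $\mathbb F_p$ is a perfect matching $A$ of $\mathbb F_p\setminus\{0\}$ such that, as $\{a,b\}$ runs through its $(p-1)/2$ pairs, the differences $\pm(a-b)$ run through all nonzero residues (i.e. the classes $\{\pm(a-b)\}$ represent all classes of $\mathbb F_p^\times/\{\pm1\}$). Order the nonzero residues as $1<2<\dots<p-1$. For a starter $A$ let $\varepsilon(A)=(-1)^{\operatorname{cr}(A)}$, where $\operatorname{cr}(A)$ is the number of unordered pairs of edges $\{a,c\},\{b,d\}\in A$ with $a<b<c<d$. Put $T_p=\sum_{A\text{ starter}}\varepsilon(A)\in\mathbb Z$. *)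

(* Defs.v *)
From HB Require Import structures.
From mathcomp Require Import all_boot all_order all_algebra.

Set Implicit Arguments.
Unset Strict Implicit.
Unset Printing Implicit Defensive.

Import Order.TTheory GRing.Theory Num.Theory.
Local Open Scope ring_scope.

Definition perfect_matching (T : finType) (A : {set {set T}}) (D : {set T}) :
    bool :=
  partition A D && [forall e in A, #|e| == 2%N].

(* The pair (a, b) is ordered, so both signs of each difference are covered.
   As there are (p - 1)/2 edges, each nonzero residue is then obtained exactly
   once. *)
Definition starter (p : nat) (A : {set {set 'F_p}}) : bool :=
  perfect_matching A [set~ 0] &&
  [forall d : 'F_p, (d != 0) ==>
     [exists a : 'F_p, exists b : 'F_p,
        ([set a; b] \in A) && (d == a - b)]].

(* Residues are compared through their representatives in {0, ..., p - 1}. *)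
Definition crosses (p : nat) (e f : {set 'F_p}) : bool :=
  [exists a : 'F_p, exists b : 'F_p, exists c : 'F_p, exists d : 'F_p,
     [&& e == [set a; c], f == [set b; d] & [&& a < b, b < c & c < d]%N]].

Definition crossing_pairs (p : nat) (A : {set {set 'F_p}}) :
    {set {set {set 'F_p}}} :=
  [set [set e; f] | e in A, f in A & crosses e f].

Definition cr (p : nat) (A : {set {set 'F_p}}) : nat := #|crossing_pairs A|.

Definition starter_sign (p : nat) (A : {set {set 'F_p}}) : int :=
  (-1) ^+ cr A.

Definition starter_sum (p : nat) : int :=
  \sum_(A : {set {set 'F_p}} | starter A) starter_sign A.

Definition legendre (a : int) (p : nat) : int :=
  if (p %| a)%Z then 0
  else if [exists x : 'F_p, x ^+ 2 == a%:~R] then 1 else -1.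

(* Main.v *)
Require Import Defs.
From HB Require Import structures.
From mathcomp Require Import all_boot all_order all_algebra.
From mathcomp Require Import all_fingroup all_field zify ring.

Set Implicit Arguments.
Unset Strict Implicit.
Unset Printing Implicit Defensive.

Import Order.TTheory GRing.Theory Num.Theory.
Local Open Scope ring_scope.

(* Write p = 2n + 1. Summing det (x_k^l)_(1 <= k, l <= 2n) over all a in F_p^n,
   where x runs through the a_i followed by the a_i + d_i, gives a sum S(d) in
   F_p. Expanding the determinant and using the power sums over F_p, only the
   permutations that pair the exponents j and p - j survive, so
   S(d) = K * prod_i d_i with K independent of d.
   On the other hand the determinant vanishes unless the x_k are all the nonzero
   residues, and then Vandermonde's formula shows that it is the sign of the
   matching {a_i, a_i + d_i} times (-1)^(sum_i d_i) times a nonzero constant.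
   For d = (1, ..., 1) the only matching is {1, 2}, {3, 4}, ..., which yields
   K; for d = (1, ..., n) the matchings are the starters. Comparing both,
   T_p = - (-1)^(n (n + 1) / 2), which is - (2 / p) by Gauss's lemma. *)

(** * Vandermonde products of a family made of pairs *)

Definition join_fun (T : Type) (m n : nat) (a : 'I_m -> T) (b : 'I_n -> T)
    (k : 'I_(m + n)) : T :=
  match split k with inl i => a i | inr i => b i end.

Lemma join_funl (T : Type) m n (a : 'I_m -> T) (b : 'I_n -> T) i :
  join_fun a b (lshift n i) = a i.
Proof. by rewrite /join_fun (unsplitK (inl i)). Qed.

Lemma join_funr (T : Type) m n (a : 'I_m -> T) (b : 'I_n -> T) i :
  join_fun a b (rshift m i) = b i.
Proof. by rewrite /join_fun (unsplitK (inr i)). Qed.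

(** The Vandermonde product, kept over a general ring: it is used over ['F_p] for determinants and
    over the integers, where it has a sign. *)
Definition vprod (R : comNzRingType) m (x : 'I_m -> R) : R :=
  \prod_(k < m) \prod_(l < m | (k < l)%N) (x l - x k).

Lemma eq_vprod (R : comNzRingType) m (x y : 'I_m -> R) :
  x =1 y -> vprod x = vprod y.
Proof. by move=> e; apply: eq_bigr => k _; apply: eq_bigr => l _; rewrite !e. Qed.

Lemma rmorph_vprod (R S : comNzRingType) (f : {rmorphism R -> S}) m
    (x : 'I_m -> R) : f (vprod x) = vprod (f \o x).
Proof.
rewrite rmorph_prod; apply: eq_bigr => k _; rewrite rmorph_prod.
by apply: eq_bigr => l _; rewrite rmorphB.
Qed.

(** Pulling [x k] out of row [k] leaves a transposed Vandermonde matrix. Exponents start at 1, so a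
    zero point also kills the determinant. *)
Lemma det_powers (R : comNzRingType) m (x : 'I_m -> R) :
  \det (\matrix_(k < m, l < m) x k ^+ l.+1) = (\prod_k x k) * vprod x.
Proof.
have -> : \matrix_(k < m, l < m) x k ^+ l.+1 =
    diag_mx (\row_k x k) *m (Vandermonde m (\row_k x k))^T.
  by apply/matrixP => k l; rewrite mul_diag_mx !mxE exprS.
rewrite det_mulmx det_diag det_tr det_Vandermonde; congr (_ * _).
  by apply: eq_bigr => k _; rewrite mxE.
by apply: eq_bigr => k _; apply: eq_bigr => l _; rewrite !mxE.
Qed.

Lemma vprod_join (R : comNzRingType) n (a b : 'I_n -> R) :
  vprod (join_fun a b) =
    vprod a * vprod b * \prod_(i < n) \prod_(j < n) (b j - a i).
Proof.
rewrite /vprod big_split_ord /=.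
under eq_bigr => i _.
  rewrite big_split_ord /=.
  under eq_bigr => j _ do rewrite !join_funl.
  under [X in _ * X]eq_bigl => j.
    by rewrite (leq_trans (ltn_ord i) (leq_addr _ _)); over.
  under [X in _ * X]eq_bigr => j _ do rewrite join_funl join_funr.
  over.
under [X in _ * X]eq_bigr => i _.
  rewrite big_split_ord /= big_pred0 ?mul1r; last first.
    by move=> j; rewrite ltnNge ltnW // (leq_trans (ltn_ord j)) ?leq_addr.
  under eq_bigl => j do rewrite ltn_add2l.
  under eq_bigr => j _ do rewrite !join_funr.
  over.
by rewrite big_split /= mulrAC.
Qed.

(** The four Vandermonde factors linking pairs [i] and [j], up to one sign. Over integer
    representatives of four distinct points it is negative exactly when the two chords cross. *)
Definition quad (R : comNzRingType) n (a b : 'I_n -> R) (i j : 'I_n) : R :=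
  (a j - a i) * (b j - b i) * (b j - a i) * (a j - b i).

Lemma prod_pairs (R : comNzRingType) n (F : 'I_n -> 'I_n -> R) :
  \prod_(i < n) \prod_(j < n) F i j =
  (\prod_(i < n) F i i) * \prod_(i < n) \prod_(j < n | (i < j)%N) (F i j * F j i).
Proof.
transitivity (\prod_(i < n) (F i i * ((\prod_(j < n | (i < j)%N) F i j) *
   (\prod_(j < n | (j < i)%N) F i j)))).
  apply: eq_bigr => i _; rewrite (bigD1 i) //=; congr (_ * _).
  rewrite (bigID (fun j : 'I_n => (i < j)%N)) /=; congr (_ * _).
    by apply: eq_bigl => j; rewrite -val_eqE /=; lia.
  by apply: eq_bigl => j; rewrite -val_eqE /=; lia.
rewrite !big_split /=; congr (_ * _).
under [in RHS]eq_bigr => i _ do rewrite big_split.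
rewrite big_split /=; congr (_ * _).
by rewrite (exchange_big_dep predT).
Qed.

(** The sign collected by turning [b i - a j] into [a j - b i] for all [i < j]. It is left
    unevaluated, since it ends up in a constant that cancels. *)
Definition pair_sign (R : comNzRingType) n : R :=
  \prod_(i < n) \prod_(j < n | (i < j)%N) -1.

Lemma vprod_quad (R : comNzRingType) n (a b : 'I_n -> R) :
  vprod (join_fun a b) =
    pair_sign R n * (\prod_(i < n) (b i - a i)) *
    \prod_(i < n) \prod_(j < n | (i < j)%N) quad a b i j.
Proof.
rewrite vprod_join prod_pairs mulrCA [pair_sign _ _ * _]mulrC -!mulrA.
congr (_ * _); rewrite /vprod /pair_sign -!big_split /=.
apply: eq_bigr => i _; rewrite -!big_split /=.
by apply: eq_bigr => j _; rewrite /quad; ring.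
Qed.

(** The square of the absolute value is a product over all ordered pairs of distinct indices, which
    is invariant under reindexing. *)
Lemma absz_vprod m (x y : 'I_m -> int) (s : 'I_m -> 'I_m) :
  injective s -> x =1 y \o s -> `|vprod x| = `|vprod y|.
Proof.
move=> s_inj xy; apply: (pexpIrn (n := 2)); rewrite ?nnegrE //.
have sqr (z : 'I_m -> int) :
    `|vprod z| ^+ 2 = \prod_k \prod_(l | l != k) `|z l - z k|.
  transitivity (\prod_k \prod_l (if l != k then `|z l - z k| else 1)); last first.
    by apply: eq_bigr => k _; rewrite -big_mkcond.
  rewrite prod_pairs big1 ?mul1r => [|i _]; last by rewrite eqxx.
  rewrite /vprod normr_prod expr2 -big_split; apply: eq_bigr => k _ /=.
  rewrite normr_prod -big_split; apply: eq_bigr => l lt_kl /=.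
  by rewrite -!val_eqE /= gtn_eqF // ltn_eqF // [in X in _ * X]distrC.
rewrite !sqr [in RHS](reindex_inj s_inj); apply: eq_bigr => k _.
rewrite [in RHS](reindex_inj s_inj); apply: eq_big => l.
  by rewrite (inj_eq s_inj).
by rewrite !xy.
Qed.

(** * Power sums over the prime field *)

Section PrimeField.
Variables (p : nat) (p_prime : prime p).

Lemma natr_Fp_eq0 m : (m%:R == 0 :> 'F_p) = (p %| m)%N.
Proof. by rewrite -val_eqE /= val_Fp_nat. Qed.

Lemma Fp_expr_pred (x : 'F_p) : x != 0 -> x ^+ p.-1 = 1.
Proof.
move=> x0; apply: (mulfI x0); rewrite mulr1 -exprS prednK ?prime_gt0 //.
by have := expf_card x; rewrite card_Fp.
Qed.

(** The sum of $(1+x)^{e+1} - x^{e+1}$ vanishes by translation. Expanding it, the lower power sums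
    vanish by induction and $(e+1)\sum x^e$ remains, with $e+1$ invertible. *)
Lemma sum_Fp_expr e : (e < p.-1)%N -> \sum_(x : 'F_p) x ^+ e = 0.
Proof.
elim/ltn_ind: e => e IH lt_ep; apply: (@mulfI _ e.+1%:R).
  by rewrite natr_Fp_eq0 gtnNdvd //; lia.
rewrite mulr0; transitivity (\sum_(x : 'F_p) ((1 + x) ^+ e.+1 - x ^+ e.+1)).
  transitivity (\sum_(x : 'F_p) \sum_(m < e.+1) x ^+ m *+ 'C(e.+1, m)).
    rewrite exchange_big [in RHS]big_ord_recr /= [in RHS]big1 => [|m _].
      by rewrite add0r sumrMnl mulr_natl binSn.
    by rewrite sumrMnl IH ?mul0rn //; have := ltn_ord m; lia.
  apply: eq_bigr => x _; rewrite exprDn [in RHS]big_ord_recr /= subnn binn mulr1n.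
  by rewrite expr1n mul1r addrK; apply: eq_bigr => m _; rewrite expr1n mul1r.
rewrite sumrB [X in _ - X](reindex_inj (addrI 1)) /=.
exact: subrr.
Qed.

Lemma sum_Fp_expr_pred : \sum_(x : 'F_p) x ^+ p.-1 = -1.
Proof.
rewrite (bigD1 0) //= expr0n; have -> : (p.-1 == 0)%N = false.
  by have := prime_gt1 p_prime; lia.
rewrite add0r (eq_bigr (fun=> 1)) => [|x x0]; last exact: Fp_expr_pred.
rewrite sumr_const (_ : #|_| = p.-1); last first.
  by have := cardC1 (0 : 'F_p); rewrite card_Fp // => <-.
apply/eqP; rewrite eq_sym -subr_eq0 -opprD oppr_eq0 addrC.
by rewrite natr1 prednK ?prime_gt0 // natr_Fp_eq0.
Qed.

(** The term $x^k$ cancels, so the polynomial has degree at most $j+k-1 \le p-1$. Only $x^{p-1}$ has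
    a nonzero power sum; it occurs only for $j+k=p$, with coefficient $kd$. *)
Lemma sum_shift_expr (d : 'F_p) j k : (0 < j)%N -> (0 < k)%N -> (j + k <= p)%N ->
  \sum_(x : 'F_p) x ^+ j * ((x + d) ^+ k - x ^+ k) =
  if (j + k == p)%N then - (k%:R * d) else 0.
Proof.
move=> j0; case: k => // k _ le_jk.
transitivity (\sum_(x : 'F_p) \sum_(m < k.+1)
  (d ^+ (k.+1 - m) *+ 'C(k.+1, m)) * x ^+ (j + m)).
  apply: eq_bigr => x _; rewrite [x + d]addrC exprDn big_ord_recr /=.
  rewrite subnn binn mulr1n mul1r addrK mulr_sumr; apply: eq_bigr => m _.
  by rewrite mulrnAr mulrnAl mulrCA exprD.
rewrite exchange_big big_ord_recr /= big1 => [|m _]; last first.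
  by rewrite -mulr_sumr sum_Fp_expr ?mulr0 //; have := ltn_ord m; lia.
rewrite add0r -mulr_sumr subSnn binSn; case: eqP => [e|ne].
  by rewrite (_ : j + k = p.-1)%N ?sum_Fp_expr_pred; [rewrite expr1; ring | lia].
by rewrite sum_Fp_expr ?mulr0 //; lia.
Qed.

End PrimeField.

(** * The quadratic character of 2 *)

Section Legendre.
Variables (p n : nat) (p_prime : prime p) (def_p : p = (n + n).+1).

Lemma natr_Fp_inj (i j : nat) : (i < p)%N -> (j < p)%N ->
  i%:R = j%:R :> 'F_p -> i = j.
Proof.
move=> ip jp /(congr1 val) /=; rewrite !val_Fp_nat //.
by rewrite !modn_small.
Qed.

Lemma natr_Fp_rev i : (i <= p)%N -> (p - i)%:R = - i%:R :> 'F_p.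
Proof.
move=> ip; apply/eqP; rewrite -addr_eq0 -natrD subnK //.
by rewrite natr_Fp_eq0.
Qed.

Lemma sum_ordS m : (\sum_(i < m) i.+1 = 'C(m.+1, 2))%N.
Proof.
by rewrite -(big_mkord xpredT S) -bin2_sum big_nat_recl //= add0n.
Qed.

(* Gauss's lemma: the even numbers up to [2n] are the even [m <= n] together
   with the [p - m] for the odd [m <= n]. *)
Lemma Fp_two_expr : 2 ^+ n = (-1) ^+ 'C(n.+1, 2) :> 'F_p.
Proof.
have factE : n`!%:R = \prod_(i < n) i.+1%:R :> 'F_p.
  by rewrite fact_prod natr_prod big_add1 big_mkord.
have fact_neq0 : n`!%:R != 0 :> 'F_p.
  rewrite factE; apply/prodf_neq0 => i _.
  by rewrite natr_Fp_eq0 // gtnNdvd // def_p; have := ltn_ord i; lia.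
apply: (mulIf fact_neq0).
rewrite factE.
pose h (i : 'I_n) := (if odd i then i./2 else n - i./2.+1)%N.
have h_lt i : (h i < n)%N by rewrite /h; case: ifP => _; have := ltn_ord i; lia.
have h_inj : injective (fun i => Ordinal (h_lt i)).
  move=> i j /(congr1 val); rewrite /= /h => e; apply: val_inj => /=.
  move: e; have := ltn_ord i; have := ltn_ord j.
  by have := odd_double_half i; have := odd_double_half j; do 2!case: odd; lia.
transitivity (\prod_(i < n) ((h i).+1.*2%:R : 'F_p)).
  under [RHS]eq_bigr => i _ do rewrite -mul2n natrM.
  rewrite big_split /= prodr_const card_ord; congr (_ * _).
  by rewrite (reindex_inj h_inj).
(* The exponent is split as $1+\dots+n$, giving one sign $(-1)^m$ for each $m = i+1$. For odd $m$ it
   accounts for $p-m=-m$. *)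
rewrite -sum_ordS -prodrXr -big_split.
apply: eq_bigr => i _ /=; rewrite -signr_odd /= /h.
case: (boolP (odd i)) => /= oi.
  by rewrite expr0 mul1r; congr (_%:R); have := odd_double_half i; rewrite oi; lia.
rewrite expr1 mulN1r -natr_Fp_rev; last by have := ltn_ord i; lia.
congr (_%:R); have := odd_double_half i; have := ltn_ord i.
by rewrite (negbTE oi) def_p; lia.
Qed.

(** If [x] were not a square, then [x] and the squares of $1,\dots,n$ would be $n+1$ distinct roots
    of $X^n-1$. *)
Lemma Fp_square_expr (x : 'F_p) : x ^+ n = 1 -> exists y, y ^+ 2 = x.
Proof.
move=> xn.
have [/existsP [y /eqP]|/existsPn nsq] := boolP [exists y : 'F_p, y ^+ 2 == x].
  by exists y.
have n0 : (0 < n)%N by have := prime_gt1 p_prime; lia.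
pose rs := x :: [seq (i.+1%:R : 'F_p) ^+ 2 | i <- iota 0 n].
have uniq_rs : uniq rs.
  rewrite /rs cons_uniq; apply/andP; split.
    by apply/mapP => -[i _ e]; have /eqP := nsq i.+1%:R; rewrite e.
  rewrite map_inj_in_uniq ?iota_uniq // => i j; rewrite !mem_iota => i_lt j_lt /eqP.
  rewrite eqf_sqr => /orP[/eqP/natr_Fp_inj|].
    by move=> e; apply: succn_inj; apply: e; lia.
  by rewrite -addr_eq0 -natrD natr_Fp_eq0 // => /dvdn_leq; lia.
have sz : size ('X^n - 1%:P : {poly 'F_p}) = n.+1.
  by rewrite size_XnsubC.
have : (size rs < size ('X^n - 1%:P : {poly 'F_p})%R)%N.
  apply: max_poly_roots => //; first by rewrite -size_poly_eq0 sz.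
  apply/allP => y; rewrite rootE !hornerE inE => /orP[/eqP->|/mapP[i]].
    by rewrite xn subrr.
  rewrite mem_iota => i_lt ->; rewrite -exprM mul2n -addnn.
  rewrite (_ : n + n = p.-1)%N ?Fp_expr_pred ?subrr //; last by rewrite def_p.
  by rewrite natr_Fp_eq0 // gtnNdvd //; lia.
by rewrite sz /= size_map size_iota ltnn.
Qed.

(** By Euler's criterion, 2 is a square exactly when $2^n=1$. Since $1\ne-1$ in ['F_p], this fixes
    the parity of the exponent, and so the integer sign. *)
Lemma legendre2 : legendre 2 p = (-1) ^+ 'C(n.+1, 2).
Proof.
have two_neq0 : 2%:R != 0 :> 'F_p.
  by rewrite natr_Fp_eq0 // gtnNdvd //; have := prime_gt1 p_prime; lia.
rewrite /legendre (_ : (p %| 2)%Z = false); last first.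
  by apply: negbTE; move: two_neq0; rewrite natr_Fp_eq0.
case: existsP => [[x /eqP xx] | nex].
  have := Fp_two_expr; rewrite -[2]/(2%:R) -[2%:R]/(2%:~R) -xx -exprM mul2n -addnn.
  rewrite (_ : n + n = p.-1)%N ?Fp_expr_pred //; first last.
  - by rewrite def_p.
  - by apply: contraNneq two_neq0 => x0; rewrite -[2%:R]/(2%:~R) -xx x0 expr0n.
  rewrite -(@signr_odd 'F_p) -(@signr_odd int); case: odd => // /eqP.
  by rewrite expr1 -subr_eq0 opprK -[1]/(1%:R) -natrD (negbTE two_neq0).
have := Fp_two_expr; rewrite -(@signr_odd 'F_p) -(@signr_odd int).
case: odd => //; rewrite expr0 => /Fp_square_expr [y yy].
by case: nex; exists y; rewrite yy.
Qed.

End Legendre.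

(** * Expansion of the determinant sum *)

Lemma det_col_mx_subr (R : comNzRingType) n (A B : 'M[R]_(n, n + n)) :
  \det (col_mx A (B - A)) = \det (col_mx A B).
Proof.
have -> : col_mx A (B - A) = block_mx 1%:M 0 (- 1%:M) 1%:M *m col_mx A B.
  by rewrite mul_block_col mul1mx mul0mx addr0 mulNmx !mul1mx addrC.
by rewrite det_mulmx det_lblock !det1 !mul1r.
Qed.

Section ShiftSum.
Variables (p n : nat) (p_prime : prime p) (def_p : p = (n + n).+1).

Definition shift_pts (d a : 'I_n -> 'F_p) : 'I_(n + n) -> 'F_p :=
  join_fun a (fun i => a i + d i).

Definition shift_sum (d : 'I_n -> 'F_p) : 'F_p :=
  \sum_(a : {ffun 'I_n -> 'F_p})
    \det (\matrix_(k < n + n, l < n + n) shift_pts d a k ^+ l.+1).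

(** Row [a i] is first subtracted from row [a i + d i], so that [sum_shift_expr] will apply. Each
    permutation then gives a product in which factor [i] involves [a i] alone. *)
Lemma det_shift_pts (d a : 'I_n -> 'F_p) :
  \det (\matrix_(k < n + n, l < n + n) shift_pts d a k ^+ l.+1) =
  \sum_(s : 'S_(n + n)) (-1) ^+ s *
    \prod_(i < n) (a i ^+ (s (lshift n i)).+1 *
      ((a i + d i) ^+ (s (rshift n i)).+1 - a i ^+ (s (rshift n i)).+1)).
Proof.
pose A := \matrix_(i < n, l < n + n) a i ^+ l.+1.
pose B := \matrix_(i < n, l < n + n) (a i + d i) ^+ l.+1.
transitivity (\det (col_mx A B)).
  congr (\det _); apply/matrixP => k l; rewrite !mxE /shift_pts /join_fun.
  by case: (split k) => i; rewrite mxE.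
rewrite -det_col_mx_subr; apply: eq_bigr => s _; congr (_ * _).
rewrite big_split_ord /= -big_split; apply: eq_bigr => i _ /=.
by rewrite col_mxEu col_mxEd !mxE.
Qed.

(** The pair totals thus have mean [p], which singles out the permutations with all totals equal to
    [p]. *)
Lemma sum_perm_pairs (s : 'S_(n + n)) :
  (\sum_(i < n) ((s (lshift n i)).+1 + (s (rshift n i)).+1) = n * p)%N.
Proof.
rewrite big_split /= -(@big_split_ord _ 0%N addn n n xpredT (fun k => (s k).+1)) /=.
rewrite -(@reindex_inj _ addn 0%N _ _ xpredT (fun k : 'I_(n + n) => k.+1)
  (@perm_inj _ s)) /=.
rewrite -(big_mkord xpredT S).
have := bin2_sum (n + n).+1; rewrite big_nat_recl //= add0n => ->.
by rewrite bin2odd /= ?oddD ?addbb // [in (_./2)%N]addnn doubleK def_p mulnC.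
Qed.

Lemma shift_sum_linear :
  exists K, forall d, shift_sum d = (\prod_(i < n) d i) * K.
Proof.
exists (\sum_(s : 'S_(n + n) |
     [forall i, (s (lshift n i)).+1 + (s (rshift n i)).+1 == p]%N)
   (-1) ^+ s * \prod_(i < n) - (s (rshift n i)).+1%:R) => d.
rewrite /shift_sum; under eq_bigr => a _ do rewrite det_shift_pts.
rewrite exchange_big mulr_sumr [RHS]big_mkcond; apply: eq_bigr => s _.
(* The sum over all families is a product of sums over a single coordinate. *)
rewrite -mulr_sumr -(bigA_distr_bigA (fun i (x : 'F_p) =>
  x ^+ (s (lshift n i)).+1 *
  ((x + d i) ^+ (s (rshift n i)).+1 - x ^+ (s (rshift n i)).+1))).
case: forallP => [sE | nsE].
  rewrite mulrCA -big_split; congr (_ * _); apply: eq_bigr => i _ /=.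
  by rewrite sum_shift_expr ?(eqP (sE i)) ?eqxx // mulrN mulrC.
(* Totals of mean [p] that are not all [p] include one below [p], whose factor vanishes. Totals
   above [p] never have to be evaluated. *)
have [i lt_i] : exists i, ((s (lshift n i)).+1 + (s (rshift n i)).+1 < p)%N.
  apply/existsP; apply: contra_notT nsE; rewrite negb_exists => /forallP ge_p.
  have := sum_perm_pairs s.
  have [_ ] : (n * p <= \sum_(i < n) ((s (lshift n i)).+1 + (s (rshift n i)).+1)
      ?= iff [forall i, p == (s (lshift n i)).+1 + (s (rshift n i)).+1])%N.
    rewrite -[n in (n * p)%N]card_ord -sum_nat_const.
    by apply: leqif_sum => i _; split=> //; rewrite leqNgt ge_p.
  by move=> + tot; rewrite tot eqxx => /esym/forallP e i; rewrite eq_sym.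
rewrite (bigD1 i) //= sum_shift_expr //; last exact: ltnW.
by rewrite ltn_eqF // mul0r mulr0.
Qed.

End ShiftSum.

(** * Families running through all nonzero residues, and their Vandermonde sign *)

Section Spanning.
Variables (p n : nat) (p_prime : prime p) (def_p : p = (n + n).+1).

Definition spanning (x : 'I_(n + n) -> 'F_p) : bool :=
  [set x k | k : 'I_(n + n)] == [set~ 0].

Lemma card_Fp_nonzero : #|[set~ (0 : 'F_p)]| = (n + n)%N.
Proof. by rewrite cardsC1 card_Fp // def_p. Qed.

(** There are as many indices as nonzero residues. *)
Lemma spanningP x : reflect (injective x /\ forall k, x k != 0) (spanning x).
Proof.
apply: (iffP eqP) => [x_im | [x_inj x_neq0]].
  split=> [|k]; last first.
    have : x k \in [set x k | k : 'I_(n + n)] by apply: imset_f.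
    by rewrite x_im !inE.
  have /imset_injP x_inj : #|[set x k | k : 'I_(n + n)]| == #|'I_(n + n)|.
    by rewrite x_im card_Fp_nonzero card_ord.
  by move=> k l; apply: x_inj.
apply/eqP; rewrite eqEcard card_imset // card_Fp_nonzero card_ord leqnn andbT.
by apply/subsetP => _ /imsetP[k _ ->]; rewrite !inE x_neq0.
Qed.

Lemma ltn_Fp (z : 'F_p) : (z < p)%N.
Proof. by rewrite -[p in (_ < p)%N](Fp_cast p_prime) ltn_ord. Qed.

Lemma Fp_pos (z : 'F_p) : z != 0 -> (0 < z)%N.
Proof. by move=> z0; rewrite lt0n; apply: contraNneq z0 => z0; apply/eqP/val_inj. Qed.

Lemma spanning_perm x : spanning x ->
  exists2 s : 'I_(n + n) -> 'I_(n + n), injective s &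
    forall k, x k = (s k).+1 :> nat.
Proof.
case/spanningP => x_inj x_neq0.
have s_lt k : ((x k : nat).-1 < n + n)%N.
  by have := ltn_Fp (x k); have := Fp_pos (x_neq0 k); lia.
have sE k : x k = (Ordinal (s_lt k)).+1 :> nat by rewrite /= prednK ?Fp_pos.
exists (fun k => Ordinal (s_lt k)) => // k l /(congr1 (fun s : 'I_(n + n) => s.+1)).
by rewrite -!sE => /val_inj/x_inj.
Qed.

Lemma sgz_norm (m : int) : m = sgz m * `|m|.
Proof. by rewrite {1}[m]intEsg abszE. Qed.

(** The absolute value shared by the integer Vandermonde products of all spanning families, so that
    only their signs vary. *)
Definition ord_vprod : int := `|vprod (fun k : 'I_(n + n) => k.+1%:Z)|.

Lemma ord_vprod_neq0 : ord_vprod%:~R != 0 :> 'F_p.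
Proof.
suff: (vprod (fun k : 'I_(n + n) => k.+1%:Z))%:~R != 0 :> 'F_p.
  by rewrite /ord_vprod [X in X%:~R != _ -> _]sgz_norm rmorphM mulf_eq0 negb_or => /andP[].
rewrite rmorph_vprod; apply/prodf_neq0 => k _; apply/prodf_neq0 => l lt_kl /=.
rewrite subr_eq0 -!pmulrn; apply/eqP => /(natr_Fp_inj p_prime) e.
suff: l.+1 = k.+1 :> nat by lia.
by apply: e; rewrite def_p ltnS.
Qed.

Lemma spanning_vprod x : spanning x ->
  `|vprod (fun k => (x k : nat)%:Z)| = ord_vprod.
Proof.
case/spanning_perm => s s_inj xs.
by apply: (absz_vprod s_inj) => k /=; rewrite xs.
Qed.

(** Used modulo 2 only: the representatives of a spanning family have a total of the parity of
    [n]. *)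
Lemma spanning_sum x : spanning x -> (\sum_k x k = n * p)%N.
Proof.
case/spanning_perm => s s_inj xs; under eq_bigr => k _ do rewrite xs.
rewrite -(@reindex_inj _ addn 0%N _ _ xpredT (fun k : 'I_(n + n) => k.+1) s_inj).
by rewrite sum_ordS bin2odd /= ?oddD ?addbb // [in (_./2)%N]addnn doubleK def_p mulnC.
Qed.

Lemma Fp_natK (z : 'F_p) : (z : nat)%:R = z.
Proof. exact: natr_Zp. Qed.

Lemma spanning_prod x : spanning x -> \prod_k x k = (p.-1)`!%:R.
Proof.
case/spanning_perm => s s_inj xs.
transitivity (\prod_k (s k).+1%:R : 'F_p).
  by apply: eq_bigr => k _; rewrite -xs Fp_natK.
rewrite -(@reindex_inj _ *%R 1 _ _ xpredT (fun k : 'I_(n + n) => k.+1%:R) s_inj).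
by rewrite -natr_prod def_p fact_prod big_add1 big_mkord.
Qed.

Lemma det_not_spanning x : ~~ spanning x ->
  \det (\matrix_(k < n + n, l < n + n) x k ^+ l.+1) = 0.
Proof.
rewrite det_powers => nx; apply/eqP; apply: contraNT nx.
rewrite mulf_eq0 negb_or => /andP[/prodf_neq0 x0 /prodf_neq0 v0].
apply/spanningP; split=> [k l e|k]; last exact: x0.
apply: val_inj; case: (ltngtP k l) => // lt.
  by have /prodf_neq0/(_ l lt) := v0 k isT; rewrite e subrr eqxx.
by have /prodf_neq0/(_ k lt) := v0 l isT; rewrite e subrr eqxx.
Qed.

Lemma Fp_Wilson : (p.-1)`!%:R = -1 :> 'F_p.
Proof.
apply/eqP; rewrite -addr_eq0 natr1 natr_Fp_eq0 // -Wilson //.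
exact: prime_gt1.
Qed.

(** For a spanning family, each crossing pair of chords contributes $-1$ and every other pair
    $1$. *)
Definition quad_sign (a b : 'I_n -> 'F_p) : int :=
  \prod_(i < n) \prod_(j < n | (i < j)%N)
    sgz (quad (fun i => (a i : nat)%:Z) (fun i => (b i : nat)%:Z) i j).

Lemma sgz_prod (I : Type) (r : seq I) (P : pred I) (F : I -> int) :
  sgz (\prod_(i <- r | P i) F i) = \prod_(i <- r | P i) sgz (F i).
Proof. exact: (big_morph _ (@sgzM _) (sgz1 _)). Qed.

(* As [p] is odd, the sum [a + d] wraps around modulo [p] exactly when the
   representatives of [a], [d] and [a + d] have an odd total. *)
Lemma sgz_shift (a d : 'F_p) : d != 0 ->
  sgz (((a + d)%R : nat)%:Z - (a : nat)%:Z) = (-1) ^+ (a + (a + d)%R + d)%N.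
Proof.
move=> /Fp_pos d_gt0; have a_lt := ltn_Fp a; have d_lt := ltn_Fp d.
have sE : ((a + d)%R : nat) = ((a + d) %% p)%N.
  by rewrite -(val_Fp_nat p_prime) natrD !Fp_natK.
rewrite -signr_odd {}sE; case: (ltnP (a + d) p) => ad.
  rewrite modn_small // (_ : odd _ = false) ?gtr0_sgz //; lia.
rewrite (_ : (a + d) %% p = a + d - p)%N; last first.
  by rewrite -[in LHS](subnK ad) modnDr modn_small //; lia.
rewrite (_ : odd _ = true) ?ltr0_sgz //; lia.
Qed.

(** In the factorization [vprod_quad], the differences inside the pairs have signs given by
    [sgz_shift]. Their exponents add up to the total of the representatives plus that of the [d i],
    and [spanning_sum] makes the former congruent to [n] modulo 2. *)
Lemma spanning_sign (d a : 'I_n -> 'F_p) : (forall i, d i != 0) ->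
  spanning (shift_pts d a) ->
  sgz (vprod (fun k => (shift_pts d a k : nat)%:Z)) =
  sgz (pair_sign int n) * (-1) ^+ (n + \sum_i d i)%N *
    quad_sign a (fun i => a i + d i).
Proof.
move=> d_neq0 sp.
have -> : vprod (fun k => (shift_pts d a k : nat)%:Z) =
   vprod (join_fun (fun i => (a i : nat)%:Z) (fun i => ((a i + d i)%R : nat)%:Z)).
  by apply: eq_vprod => k; rewrite /shift_pts /join_fun; case: (split k).
rewrite vprod_quad !sgzM; congr (_ * _ * _); last first.
  by rewrite sgz_prod; apply: eq_bigr => i _; rewrite sgz_prod.
rewrite sgz_prod; under eq_bigr => i _ do rewrite sgz_shift //.
rewrite prodrXr big_split -[LHS]signr_odd -[RHS]signr_odd !oddD.
congr (_ ^+ nat_of_bool _); congr addb.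
have := spanning_sum sp; rewrite big_split_ord /= -big_split /=.
under eq_bigr => i _ do rewrite /shift_pts join_funl join_funr.
by move=> ->; rewrite oddM def_p /= oddD addbb andbT.
Qed.

(** [U] is independent of [d], so it cancels when two choices of [d] are compared. It collects the
    product of the points, [ord_vprod] and the constant signs of [spanning_sign]. *)
Lemma shift_sum_spanning : exists2 U : 'F_p, U != 0 &
  forall d : 'I_n -> 'F_p, (forall i, d i != 0) ->
  shift_sum d = U * (-1) ^+ (\sum_i d i)%N *
   (\sum_(a : {ffun 'I_n -> 'F_p} | spanning (shift_pts d a))
      quad_sign a (fun i => a i + d i))%:~R.
Proof.
exists ((p.-1)`!%:R * ord_vprod%:~R * (sgz (pair_sign int n))%:~R * (-1) ^+ n).
  rewrite !mulf_neq0 ?ord_vprod_neq0 ?signr_eq0 //.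
    by rewrite Fp_Wilson oppr_eq0 oner_eq0.
  rewrite sgz_prod rmorph_prod; apply/prodf_neq0 => i _.
  rewrite sgz_prod rmorph_prod; apply/prodf_neq0 => j _.
  by rewrite sgzN1 rmorphN1 oppr_eq0 oner_eq0.
move=> d d_neq0; rewrite /shift_sum.
rewrite (bigID (fun a : {ffun 'I_n -> 'F_p} => spanning (shift_pts d a))) /=.
rewrite [X in _ + X]big1 ?addr0 => [|a /det_not_spanning //].
rewrite rmorph_sum mulr_sumr; apply: eq_bigr => a sp /=.
rewrite det_powers spanning_prod //.
(* The product is lifted to integer representatives, where it is a sign times [ord_vprod]. *)
have -> : vprod (shift_pts d a) = (vprod (fun k => (shift_pts d a k : nat)%:Z))%:~R.
  by rewrite rmorph_vprod; apply: eq_vprod => k /=; rewrite -pmulrn Fp_natK.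
rewrite [vprod _]sgz_norm (spanning_sign d_neq0 sp) spanning_vprod //.
rewrite !rmorphM /= !rmorphXn /= rmorphN1 exprD.
ring.
Qed.
End Spanning.

(** * The case where all differences are 1 *)

Section UnitShift.
Variables (p n : nat) (p_prime : prime p) (def_p : p = (n + n).+1).

Lemma spanning_shiftP (d a : 'I_n -> 'F_p) :
  reflect [/\ injective a, injective (fun i => a i + d i),
              forall i, a i != 0, forall i, a i + d i != 0 &
              forall i j, a i != a j + d j]
          (spanning (shift_pts d a)).
Proof.
apply: (iffP (spanningP p_prime def_p _)) => [[inj n0] | [injl injr nl nr nlr]].
  split=> [i j e|i j e|i|i|i j].
  - by apply: (@lshift_inj n n); apply: inj; rewrite /shift_pts !join_funl.
  - by apply: (@rshift_inj n n); apply: inj; rewrite /shift_pts !join_funr.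
  - by have := n0 (lshift n i); rewrite /shift_pts join_funl.
  - by have := n0 (rshift n i); rewrite /shift_pts join_funr.
  - have := inj (lshift n i) (rshift n j); rewrite /shift_pts join_funl join_funr.
    by move=> e; apply/eqP => /e /eqP; rewrite eq_lrshift.
split=> [k l|k]; rewrite /shift_pts; last first.
  by case: (split_ordP k) => i ->; rewrite ?join_funl ?join_funr.
case: (split_ordP k) => i ->; case: (split_ordP l) => j ->;
  rewrite ?join_funl ?join_funr.
- by move/injl->.
- by move/eqP; rewrite (negbTE (nlr i j)).
- by move/esym/eqP; rewrite (negbTE (nlr j i)).
- by move/injr->.
Qed.

Lemma Fp_succ (z : 'F_p) : z + 1 != 0 -> (z + 1)%R = z.+1 :> nat.
Proof.
move=> z1; have sE : z + 1 = z.+1%:R by rewrite -natr1 Fp_natK.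
rewrite sE val_Fp_nat // modn_small // ltn_neqAle ltn_Fp // andbT.
by apply: contraNneq z1 => e; rewrite sE e natr_Fp_eq0.
Qed.

(** By strong induction: if [a i] were an even [v], the residue [v - 1] would occur in the family.
    It is no left end, since its right end would be [a i]; so it is a right end, whose left end
    [v - 2] is even, against the induction hypothesis. *)
Lemma spanning1_odd (a : 'I_n -> 'F_p) i :
  spanning (shift_pts (fun=> 1) a) -> odd (a i).
Proof.
move=> sp; have /spanning_shiftP [inj injS a_neq0 aS_neq0 aS] := sp.
move e : (a i : nat) => v; elim/ltn_ind: v i e => v IH i e.
case: (boolP (odd v)) => // ev.
have v_gt0 : (0 < v)%N by rewrite -e Fp_pos.
have v_lt : (v < p)%N by rewrite -e ltn_Fp.
have : v.-1%:R \in [set~ 0 : 'F_p].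
  by rewrite !inE natr_Fp_eq0 // gtnNdvd //; case: v v_gt0 ev v_lt {IH e} => [|[]] //= *; lia.
move/eqP: (sp) => <- /imsetP [k _]; rewrite /shift_pts.
case: (split_ordP k) => j ->; rewrite ?join_funl ?join_funr => vE.
  by have := aS i j; rewrite -vE natr1 prednK // -e Fp_natK eqxx.
have ajE : v = (a j).+2.
  rewrite -Fp_succ // -vE val_Fp_nat // modn_small ?prednK //.
  by rewrite ltnW.
by have := IH (a j) _ j erefl; move: ev; rewrite ajE /= negbK => /negbTE -> ->.
Qed.

(** Chords joining consecutive integers do not cross: with $t$ the difference of the left ends, the
    product is $t^2(t^2-1)$, and $|t|\ge2$ by disjointness. *)
Lemma quad_sign1 (a : 'I_n -> 'F_p) : spanning (shift_pts (fun=> 1) a) ->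
  quad_sign a (fun i => a i + 1) = 1.
Proof.
case/spanning_shiftP => inj injS a_neq0 aS_neq0 aS.
rewrite /quad_sign big1 // => i _; rewrite big1 // => j lt_ij.
rewrite /quad !Fp_succ //.
have ne_ij : a i <> a j :> nat by move/val_inj/inj => e; rewrite e ltnn in lt_ij.
have ne_ijS k l : a k <> (a l).+1 :> nat.
  by rewrite -Fp_succ // => /val_inj/eqP; rewrite (negbTE (aS k l)).
have /eqP n1 := ne_ijS i j; have /eqP n2 := ne_ijS j i.
rewrite gtr0_sgz //.
set x := (a i : nat) in ne_ij n1 n2 *; set y := (a j : nat) in ne_ij n1 n2 *.
rewrite (_ : _ * _ = (y%:Z - x%:Z) ^+ 2 * ((y%:Z - x%:Z) ^+ 2 - 1)); last first.
  by rewrite !intS; ring.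
by rewrite pmulr_lgt0; nia.
Qed.

(** The left ends are the odd numbers $1,3,\dots,2n-1$ in any order, so such families correspond to
    permutations. *)
Lemma card_spanning1 :
  #|[set a : {ffun 'I_n -> 'F_p} | spanning (shift_pts (fun=> 1) a)]| = n`!.
Proof.
pose h (s : 'S_n) := [ffun i => ((s i).*2.+1)%:R : 'F_p].
have h_lt (i : 'I_n) : (i.*2.+2 < p)%N by have := ltn_ord i; lia.
have valh s i : h s i = (s i).*2.+1 :> nat.
  by rewrite ffunE val_Fp_nat // modn_small // ltnW.
have hS s i : h s i + 1 = ((s i).*2.+2)%:R by rewrite ffunE natr1.
have valhS s i : (h s i + 1)%R = (s i).*2.+2 :> nat.
  by rewrite hS val_Fp_nat // modn_small.
have h_inj : injective h.
  move=> s t /ffunP e; apply/permP => i; apply/val_inj/double_inj.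
  by have := valh s i; rewrite e valh => -[].
rewrite -card_Sn -(card_imset _ h_inj); apply: eq_card => a; rewrite inE.
apply/idP/imsetP => [sp | [s _ ->]]; last first.
  apply/spanning_shiftP; split.
  - by move=> i j /(congr1 (@nat_of_ord _)); rewrite !valh => -[/double_inj/val_inj/perm_inj].
  - move=> i j e; have e' : h s i + 1 = h s j + 1 := e.
    by have := valhS s i; rewrite e' valhS => -[/double_inj/val_inj/perm_inj].
  - by move=> i; rewrite -val_eqE /= valh.
  - by move=> i; rewrite hS natr_Fp_eq0 // gtnNdvd.
  - move=> i j; apply/eqP => /(congr1 (@nat_of_ord _)); rewrite valh valhS => /(congr1 odd).
    by rewrite /= !odd_double.
have odd_a i := spanning1_odd i sp.
have /spanning_shiftP [inj _ _ _ _] := sp.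
have s_lt i : ((a i)./2 < n)%N.
  by have := odd_double_half (a i); have := ltn_Fp p_prime (a i); rewrite odd_a; lia.
pose s i := Ordinal (s_lt i).
have s_inj : injective s.
  move=> i j /(congr1 val) /= e; apply: inj; apply: val_inj => /=.
  by rewrite -[LHS]odd_double_half -[RHS]odd_double_half !odd_a e.
exists (perm s_inj) => //; apply/ffunP => i; apply: val_inj.
by rewrite /= valh permE /= -[LHS]odd_double_half odd_a.
Qed.

Lemma sum_quad_sign1 :
  \sum_(a : {ffun 'I_n -> 'F_p} | spanning (shift_pts (fun=> 1) a))
     quad_sign a (fun i => a i + 1) = n`!%:R.
Proof.
rewrite (eq_bigr (fun=> 1)); last exact: quad_sign1.
by rewrite sumr_const -card_spanning1 cardsE.
Qed.

End UnitShift.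

(** * Crossings and the sign of a matching *)

Lemma eq_set2 (T : finType) (x y z w : T) :
  [set x; y] = [set z; w] -> (x = z /\ y = w) \/ (x = w /\ y = z).
Proof.
move=> e.
have : x \in [set z; w] by rewrite -e set21.
have : y \in [set z; w] by rewrite -e set22.
have : z \in [set x; y] by rewrite e set21.
have : w \in [set x; y] by rewrite e set22.
by rewrite !inE; do 4!case/orP=> /eqP ?; subst; auto.
Qed.

Lemma sgz_subn (m k : nat) :
  sgz (m%:Z - k%:Z) = if (k < m)%N then 1 else if (m < k)%N then -1 else 0.
Proof.
case: ltngtP => [lt|lt|->]; last by rewrite subrr.
  by rewrite gtr0_sgz //; lia.
by rewrite ltr0_sgz //; lia.
Qed.

(** Both sides depend only on the relative order of the four ends. A common end makes the product
    zero, and disjoint or nested intervals make it positive. *)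
Lemma quad_lt0_interlaced (x y z w : nat) : (x < y)%N -> (z < w)%N ->
  ((z%:Z - x%:Z) * (w%:Z - y%:Z) * (w%:Z - x%:Z) * (z%:Z - y%:Z) < 0) =
  [&& x < z, z < y & y < w]%N || [&& z < x, x < w & w < y]%N.
Proof.
move=> xy zw; rewrite -sgz_cp0 !sgzM !sgz_subn.
case: (ltngtP x z) => ?; case: (ltngtP y z) => ?; case: (ltngtP x w) => ?;
  case: (ltngtP y w) => ?; rewrite ?mulr1 ?mul1r ?mulrN1 ?mulr0 ?mul0r //=; lia.
Qed.

Lemma crosses_ordered (p : nat) (x y z w : 'F_p) : (x < y)%N -> (z < w)%N ->
  crosses [set x; y] [set z; w] = [&& x < z, z < y & y < w]%N.
Proof.
move=> xy zw; apply/existsP/idP => [[a /existsP[b /existsP[c /existsP[d]]]] | lts].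
  case/and3P=> /eqP/eq_set2 e /eqP/eq_set2 f /and3P[ab bc cd].
  by case: e => -[? ?]; case: f => -[? ?]; subst; lia.
by exists x; apply/existsP; exists z; apply/existsP; exists y; apply/existsP;
  exists w; rewrite !eqxx.
Qed.

(** [crosses] wants the smallest end in its first edge, so both orders of the edges are needed. The
    product does not change when the ends of an edge are swapped, which reduces the claim to ordered
    ends. *)
Lemma crossesE (p : nat) (x y z w : 'F_p) : x != y -> z != w ->
  crosses [set x; y] [set z; w] || crosses [set z; w] [set x; y] =
  ((z%:Z - x%:Z) * (w%:Z - y%:Z) * (w%:Z - x%:Z) * (z%:Z - y%:Z) < 0).
Proof.
wlog xy : x y / (x < y)%N.
  move=> IH; case: (ltngtP x y) => [|yx nxy nzw|/val_inj ->]; first exact: IH.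
    rewrite [[set x; y]]setUC IH //; last by rewrite eq_sym.
    by congr (_ < 0); ring.
  by rewrite eqxx.
wlog zw : z w / (z < w)%N.
  move=> IH; case: (ltngtP z w) => [|wz nxy nzw|/val_inj ->]; first exact: IH.
    rewrite [[set z; w]]setUC IH //; last by rewrite eq_sym.
    by congr (_ < 0); ring.
  by rewrite eqxx.
by move=> _ _; rewrite !crosses_ordered // quad_lt0_interlaced.
Qed.

Section Starters.
Variables (p n : nat) (p_prime : prime p) (def_p : p = (n + n).+1).

Definition edge (d a : 'I_n -> 'F_p) (i : 'I_n) : {set 'F_p} := [set a i; a i + d i].
Definition edges (d a : 'I_n -> 'F_p) : {set {set 'F_p}} :=
  [set edge d a i | i : 'I_n].

Lemma edge_inj (d a : 'I_n -> 'F_p) :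
  spanning (shift_pts d a) -> injective (edge d a).
Proof.
case/(spanning_shiftP p_prime def_p) => inj _ _ _ lr i j /eq_set2 [[/inj //]|[/eqP]].
by rewrite (negbTE (lr i j)).
Qed.

(** Crossing pairs of edges are counted by the index pairs [i < j] with negative [quad]; all these
    products are nonzero because the points are distinct. *)
Lemma starter_sign_edges (d a : 'I_n -> 'F_p) :
  spanning (shift_pts d a) ->
  starter_sign (edges d a) = quad_sign a (fun i => a i + d i).
Proof.
move=> sp; have E_inj := edge_inj sp.
have /(spanning_shiftP p_prime def_p) [inj injr a0 b0 lr] := sp.
pose q i j := quad (fun i => (a i : nat)%:Z) (fun i => ((a i + d i)%R : nat)%:Z) i j.
have crE i j : crosses (edge d a i) (edge d a j) ||
    crosses (edge d a j) (edge d a i) = (q i j < 0).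
  by rewrite /edge crossesE // lr.
have sgq i j : i != j -> sgz (q i j) = (-1) ^+ (q i j < 0)%R.
  move=> ne_ij; have : q i j != 0.
    have nz (u v : 'F_p) : u != v -> (u : nat)%:Z - (v : nat)%:Z != 0.
      by rewrite subr_eq0 eqz_nat.
    by rewrite /q /quad !mulf_neq0 // nz // 1?eq_sym ?(inj_eq inj)
      ?(inj_eq injr) // eq_sym.
  by case: (ltgtP (q i j) 0) => // h _; [rewrite ltr0_sgz | rewrite gtr0_sgz].
rewrite /quad_sign (pair_big_dep xpredT (fun i j : 'I_n => (i < j)%N)
  (fun i j => sgz (q i j))) /=.
rewrite (eq_bigr (fun u : 'I_n * 'I_n => (-1) ^+ (q u.1 u.2 < 0)%R)); last first.
  by move=> [i j] /= lt_ij; rewrite sgq // -val_eqE /= ltn_eqF.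
rewrite prodrXr /starter_sign; congr (_ ^+ _).
pose X := [set u : 'I_n * 'I_n | (u.1 < u.2)%N && (q u.1 u.2 < 0)].
pose E2 (u : 'I_n * 'I_n) := [set edge d a u.1; edge d a u.2].
transitivity #|X|; last first.
  rewrite -sum1_card big_mkcond [RHS]big_mkcond; apply: eq_bigr => u _.
  by rewrite inE; case: (u.1 < u.2)%N; case: (_ < 0).
(* An unordered pair of edges comes from only one index pair, since [i < j] excludes the swapped
   one. *)
rewrite /cr -(@card_in_imset _ _ E2 X); last first.
  move=> [i j] [k l]; rewrite !inE /= => /andP[ij _] /andP[kl _] /eq_set2.
  case=> /= -[/E_inj e1 /E_inj e2]; subst => //.
  by have := ltn_trans ij kl; rewrite ltnn.
apply: eq_card => S; apply/imset2P/imsetP => [[e f eA] | [[i j]]].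
  rewrite inE => /andP[/imsetP[j _ ->] cr_ef] ->.
  case/imsetP: eA cr_ef => i _ -> cr_ij.
  have [lt_ij|lt_ji|/val_inj e_ij] := ltngtP i j.
  - by exists (i, j); rewrite ?inE //= lt_ij -crE cr_ij.
  - by exists (j, i); rewrite ?inE /E2 //= ?lt_ji -?crE ?cr_ij ?orbT // setUC.
  (* An edge does not cross itself, as [quad] vanishes on the diagonal. *)
  - have := crE i j; rewrite e_ij in cr_ij *; rewrite cr_ij /q /quad.
    by rewrite !subrr !mul0r ltxx.
rewrite inE /= -crE => /andP[lt_ij /orP[c|c]] ->; rewrite /E2 /=.
  by exists (edge d a i) (edge d a j); rewrite ?inE ?imset_f // ?c.
by rewrite setUC; exists (edge d a j) (edge d a i); rewrite ?inE ?imset_f // ?c.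
Qed.

End Starters.

(** * Starters as spanning families, and the value of the sum *)

Section StarterSum.
Variables (p n : nat) (p_prime : prime p) (def_p : p = (n + n).+1).

(** One representative of each class of nonzero residues up to sign. *)
Definition half_diff (i : 'I_n) : 'F_p := i.+1%:R.

Lemma half_diff_neq0 i : half_diff i != 0.
Proof. by rewrite natr_Fp_eq0 // gtnNdvd //; have := ltn_ord i; lia. Qed.

Lemma half_diff_inj : injective half_diff.
Proof.
move=> i j /(natr_Fp_inj p_prime) e; apply: val_inj; apply: succn_inj.
by apply: e; have := ltn_ord i; have := ltn_ord j; lia.
Qed.

Lemma half_diffD_neq0 i j : half_diff i + half_diff j != 0.
Proof.
rewrite -natrD natr_Fp_eq0 // gtnNdvd //.
by have := ltn_ord i; have := ltn_ord j; lia.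
Qed.

Lemma half_diff_cover d : d != 0 -> exists i, d = half_diff i \/ d = - half_diff i.
Proof.
move=> /Fp_pos d_gt0; have d_lt := ltn_Fp p_prime d.
case: (leqP d n) => dn.
  have lt : (d.-1 < n)%N by lia.
  by exists (Ordinal lt); left; rewrite /half_diff /= prednK // Fp_natK.
have lt : ((p - d).-1 < n)%N by lia.
exists (Ordinal lt); right; rewrite /half_diff /= prednK; last by lia.
by rewrite natr_Fp_rev ?opprK ?Fp_natK // ltnW.
Qed.

(** Each edge of a starter is oriented so that its difference lies in $1,\dots,n$, and its base
    point is recorded under that difference. The default 0 is never reached for a starter. *)
Definition starter_base (A : {set {set 'F_p}}) : {ffun 'I_n -> 'F_p} :=
  [ffun i => odflt 0 [pick x | [set x; x + half_diff i] \in A]].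

(** Matching the ends crosswise would make two of the chosen differences opposite, which
    [half_diffD_neq0] excludes. *)
Lemma edge_half_diff_inj (a b : 'I_n -> 'F_p) i j :
  edge half_diff a i = edge half_diff b j -> i = j /\ a i = b j.
Proof.
case/eq_set2=> -[e1 e2].
  by split=> //; apply: half_diff_inj; apply: (@addrI _ (b j)); rewrite -e2 e1.
move/eqP: e2; rewrite e1 -addrA -subr_eq0 addrAC subrr add0r addrC.
by rewrite (negbTE (half_diffD_neq0 i j)).
Qed.

(** Every difference $1,\dots,n$ occurs in [A], which yields [n] distinct edges of [A]; a partition
    of $2n$ points into pairs has no more. *)
Lemma edges_starter_base A : starter A -> edges half_diff (starter_base A) = A.
Proof.
case/andP=> /andP[A_part /forallP A2] /forallP A_diff.
apply/eqP; rewrite eqEcard; apply/andP; split.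
  apply/subsetP => _ /imsetP[i _ ->]; rewrite /edge ffunE.
  case: pickP => [x //|nx]; have := A_diff (half_diff i).
  rewrite half_diff_neq0 => /existsP[a /existsP[b /andP[ab /eqP e]]].
  by have := nx b; rewrite e addrCA subrr addr0 setUC ab.
rewrite card_imset; last by move=> i j /edge_half_diff_inj [].
have := card_partition A_part; rewrite (card_Fp_nonzero p_prime def_p) card_ord.
rewrite (eq_bigr (fun=> 2)) => [|e eA]; last by apply/eqP; have := A2 e; rewrite eA.
by rewrite sum_nat_const; lia.
Qed.

(** The left side is the condition produced by reindexing the sum over starters along [edges] and
    [starter_base]. *)
Lemma starter_edges (a : {ffun 'I_n -> 'F_p}) :
  starter (edges half_diff a) && (starter_base (edges half_diff a) == a) =
  spanning (shift_pts half_diff a).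
Proof.
have pts_cover :
    [set shift_pts half_diff a k | k : 'I_(n + n)] = cover (edges half_diff a).
  apply/setP => x; apply/imsetP/bigcupP => [[k _ ->] | [_ /imsetP[i _ ->]]].
    rewrite /shift_pts; case: (split_ordP k) => i ->; rewrite ?join_funl ?join_funr;
      exists (edge half_diff a i); rewrite ?imset_f // ?set21 ?set22 //.
  case/set2P=> ->; [exists (lshift n i) | exists (rshift n i)] => //;
    by rewrite /shift_pts ?join_funl ?join_funr.
apply/andP/idP => [[/andP[/andP[/and3P[c _ _] _] _] _] | sp].
  by rewrite /spanning pts_cover.
split; last first.
  apply/eqP/ffunP => i; rewrite ffunE; case: pickP => [x|/(_ (a i))]; last first.
    by rewrite (imset_f (edge half_diff a)).
  (* The constant family [x] presents the picked pair as an edge. *)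
  by case/imsetP => j _ /(@edge_half_diff_inj (fun=> x)) [-> ->].
have /(spanning_shiftP p_prime def_p) [inj injr a0 b0 lr] := sp.
apply/andP; split; last first.
  apply/forallP => d; apply/implyP => /half_diff_cover [i [->|->]].
    apply/existsP; exists (a i + half_diff i); apply/existsP; exists (a i).
    by rewrite setUC (imset_f (edge half_diff a)) //= addrC addKr eqxx.
  apply/existsP; exists (a i); apply/existsP; exists (a i + half_diff i).
  by rewrite (imset_f (edge half_diff a)) //= opprD addNKr.
apply/andP; split; last first.
  by apply/forallP => e; apply/implyP => /imsetP[i _ ->]; rewrite cards2 lr.
apply/and3P; split; first by rewrite -pts_cover.
  apply/trivIsetP => _ _ /imsetP[i _ ->] /imsetP[j _ ->] ne_ij.
  have ne : i != j by apply: contraNneq ne_ij => ->.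
  apply/pred0P => x /=; rewrite !inE; apply/negP.
  case/andP=> /orP[/eqP->|/eqP->].
    by rewrite (inj_eq inj) (negbTE ne) (negbTE (lr i j)).
  by rewrite (inj_eq injr) (negbTE ne) eq_sym (negbTE (lr j i)).
apply/imsetP => -[i _ /setP/(_ (a i))].
by rewrite !inE eqxx.
Qed.

Lemma starter_sumE :
  starter_sum p = \sum_(a : {ffun 'I_n -> 'F_p} | spanning (shift_pts half_diff a))
    quad_sign a (fun i => a i + half_diff i).
Proof.
rewrite /starter_sum (reindex_onto (fun a : {ffun _} => edges half_diff a)
  starter_base edges_starter_base).
rewrite (eq_bigl _ _ starter_edges); apply: eq_bigr => a.
exact: starter_sign_edges.
Qed.

Lemma prod_half_diff : \prod_i half_diff i = n`!%:R.
Proof. by rewrite fact_prod natr_prod big_add1 big_mkord. Qed.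

(** In Wilson's theorem the factors above [n] are $p-m=-m$ for $m\le n$, so $(2n)! =
    (-1)^n\,n!^2$. *)
Lemma Fp_fact_half_sqr : n`!%:R ^+ 2 = (-1) ^+ n.+1 :> 'F_p.
Proof.
have p1 : p.-1 = (n + n)%N by rewrite def_p.
have := Fp_Wilson p_prime; rewrite p1 fact_prod natr_prod big_add1 big_mkord /=.
rewrite big_split_ord /= [X in X * _ = _]prod_half_diff (reindex_inj rev_ord_inj) /=.
(* In reversed order, the upper factor at index [i] is $2n-i = p-(i+1)$. *)
have rev_lt (i : 'I_n) : (n + (n - i.+1)).+1%:R = -1 * half_diff i :> 'F_p.
  rewrite mulN1r -natr_Fp_rev //; last by have := ltn_ord i; lia.
  by congr _%:R; have := ltn_ord i; lia.
rewrite (eq_bigr _ (fun i _ => rev_lt i)) big_split /= prod_half_diff.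
rewrite prodr_const card_ord => e.
have := sqrr_sign 'F_p n; rewrite [(-1) ^+ n.+1]exprS; move: ((-1) ^+ n) e => s e ss.
by rewrite -[X in X * s]e -[LHS]mulr1 -ss; ring.
Qed.

(** Unit shifts give $K = U(-1)^n n!$, and the shifts $1,\dots,n$ give $n!\,K =
    U(-1)^{\binom{n+1}{2}}T_p$. Eliminating $K$ and $U$ leaves $n!^2(-1)^n$, which is $-1$ by
    [Fp_fact_half_sqr]. *)
Lemma starter_sum_Fp : (starter_sum p)%:~R = - (-1) ^+ 'C(n.+1, 2) :> 'F_p.
Proof.
have [K KE] := shift_sum_linear p_prime def_p.
have [U U_neq0 UE] := shift_sum_spanning p_prime def_p.
have val1 : (1 : 'F_p) = 1%N :> nat.
  by rewrite -[1 : 'F_p]/(1%:R) val_Fp_nat // modn_small // prime_gt1.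
have e1 := UE (fun=> 1) (fun=> oner_neq0 _).
rewrite KE sum_quad_sign1 // big1 // mul1r rmorph_nat in e1.
have e2 := UE half_diff half_diff_neq0.
rewrite KE -starter_sumE {K KE UE}e1 prod_half_diff in e2.
have sum1 : (\sum_(i < n) (1%R : 'F_p) = n)%N.
  by rewrite (eq_bigr (fun=> 1%N)) ?sum1_card ?card_ord // => i _; exact: val1.
have sumd : (\sum_(i < n) half_diff i = 'C(n.+1, 2))%N.
  rewrite -sum_ordS; apply: eq_bigr => i _; rewrite /half_diff val_Fp_nat //.
  by rewrite modn_small //; have := ltn_ord i; lia.
rewrite sum1 sumd in e2.
have {}e2 : n`!%:R ^+ 2 * (-1) ^+ n =
    (-1) ^+ 'C(n.+1, 2) * (starter_sum p)%:~R :> 'F_p.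
  by apply: (mulfI U_neq0); rewrite [RHS]mulrA -e2; ring.
rewrite Fp_fact_half_sqr -exprD addSn exprS addnn -mul2n exprM sqrrN expr1n in e2.
rewrite expr1n mulr1 in e2.
have := sqrr_sign 'F_p 'C(n.+1, 2); move: (_ ^+ 'C(_, 2)) e2 => s e2 ss.
by rewrite -mulrN1 e2 mulrA -expr2 ss mul1r.
Qed.

End StarterSum.

Theorem lemma5p2 (p : nat) (p_prime : prime p) (p_odd : odd p) :
  (starter_sum p = - legendre 2 p %[mod p])%Z /\
  (starter_sum p ^+ 2 = 1 %[mod p])%Z.
Proof.
have def_p : p = (p./2 + p./2).+1.
  by rewrite -[LHS]odd_double_half p_odd addnn.
have leg := legendre2 p_prime def_p.
have Fp_eqmod (m k : int) : m%:~R = k%:~R :> 'F_p -> (m = k %[mod p])%Z.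
  move/eqP; rewrite -subr_eq0 -rmorphB /= => h; apply/eqP; rewrite eqz_mod_dvd.
  move: h; case: (m - k) => i.
    by rewrite -pmulrn natr_Fp_eq0.
  by rewrite NegzE mulrNz oppr_eq0 -pmulrn natr_Fp_eq0.
split; apply: Fp_eqmod.
  by rewrite (starter_sum_Fp p_prime def_p) leg rmorphN /= rmorphXn /= rmorphN1.
by rewrite rmorphXn /= (starter_sum_Fp p_prime def_p) sqrrN sqrr_sign.
Qed.
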